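(* Let $H$ be a Hopf algebra over a commutative unital integral domain $R$, let $\Pi$ be a finite subgroup of weights of $H$, and let $h\in H$ be skew-primitive, with $\Delta(h)=g\otimes h+h\otimes g'$ for grouplike $g,g'\in G(H)$. Then the following three statements hold, and $h$ falls under (the hypothesis of the evaluation of $\Sigma_\Pi(h)$ in) at least one of them: \begin{enumerate} \item If there is $\lambda\in\Pi$ with $\lambda(g)\ne1$ and $\lambda(g')\neq 1$, then $\Sigma_\Pi(h)=0$. If no such $\lambda$ exists, then one of $g,g'$ lies in $G_\Pi(H)$. \item Suppose only one of $g,g'$ lies in $G_\Pi(H)$, so that there exists $\lambda\in\Pi$ with exactly one of $\lambda(g),\lambda(g')$ equal to $1$. Then (in the fraction field of $R$) $$\Sigma_\Pi(h)=\frac{|\Pi|\,\lambda(h)}{1-\lambda(gg')}.$$ \item If $\lambda(gg')=1$ for all $\lambda\in\Pi$, then $\Sigma_\Pi(h)=\sum_{\gamma\in\Pi,\ \gamma\ne\varepsilon=\gamma^2}\gamma(h)$, and $2\,\Sigma_\Pi(h)=0$. \end{enumerate}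
   Context: A weight of $H$ is an $R$-algebra homomorphism $H\to R$. The set $\Gamma_H$ of weights is a group under convolution $(\lambda*\nu)(h)=(\lambda\otimes\nu)(\Delta(h))$, with identity the counit $\varepsilon$ and inverse $\lambda^{-1}=\lambda\circ S$; powers such as $\gamma^2$ are taken in this group. $\Pi\subset\Gamma_H$ is a finite subgroup, and $\Sigma_\Pi:=\sum_{\gamma\in\Pi}\gamma:H\to R$. $G(H)$ is the group of grouplike elements ($\Delta(g)=g\otimes g$, $\varepsilon(g)=1$), and $G_\Pi(H)=\{g\in G(H):\gamma(g)=1\ \forall\gamma\in\Pi\}$. The integer $|\Pi|$ is viewed in $R$ via $\mathbb Z\to R$. An empty sum is $0$. *)

(* Defs.v *)
From HB Require Import structures.
From mathcomp Require Import all_boot all_order all_algebra.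
From mathcomp Require Import generic_quotient finmap boolp ring.

Set Implicit Arguments.
Unset Strict Implicit.
Unset Printing Implicit Defensive.

Import GRing.Theory.
Local Open Scope ring_scope.

Notation "x %:F" := (@FracField.tofrac _ x) : ring_scope.
Reserved Notation "A ⊗ B" (at level 40, left associativity).

Section TensorProduct.
Variables (R : comPzRingType) (A B : lmodType R).

(* A sequence of pairs (a_i, b_i) stands for the formal sum of the a_i ⊗ b_i.
   Since 0 ⊗ b is identified with the empty sum, (- a) ⊗ b is an opposite of
   a ⊗ b, so that the quotient monoid is already a group. *)
Inductive tensor_rel : seq (A * B) -> seq (A * B) -> Prop :=
| tensor_rel_refl s : tensor_rel s s
| tensor_rel_sym s t : tensor_rel s t -> tensor_rel t s
| tensor_rel_trans s t u : tensor_rel s t -> tensor_rel t u -> tensor_rel s u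
| tensor_rel_cat s s' t t' :
    tensor_rel s s' -> tensor_rel t t' -> tensor_rel (s ++ t) (s' ++ t')
| tensor_rel_comm s t : tensor_rel (s ++ t) (t ++ s)
| tensor_rel_Dl a a' b : tensor_rel [:: (a + a', b)] [:: (a, b); (a', b)]
| tensor_rel_Dr a b b' : tensor_rel [:: (a, b + b')] [:: (a, b); (a, b')]
| tensor_rel_Z r a b : tensor_rel [:: (r *: a, b)] [:: (a, r *: b)]
| tensor_rel_0l b : tensor_rel [:: (0, b)] [::].

Definition tensor_relb (s t : seq (A * B)) : bool := `[< tensor_rel s t >].

Lemma tensor_relb_equiv : equiv_class_of tensor_relb.
Proof.
split=> [s|s t|t s u]; first exact/asboolP/tensor_rel_refl.
  by apply/idP/idP => /asboolP h; apply/asboolP/tensor_rel_sym.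
by move=> /asboolP h /asboolP h'; apply/asboolP/(tensor_rel_trans h h').
Qed.

Canonical tensor_equiv := EquivRelPack tensor_relb_equiv.

Definition tensor := {eq_quot tensor_equiv}%qT.
HB.instance Definition _ := Choice.on tensor.

Definition tensor_class (s : seq (A * B)) : tensor :=
  (\pi_({eq_quot tensor_equiv}) s)%qT.

Definition tensor_seq (x : tensor) : seq (A * B) :=
  @repr _ {eq_quot tensor_equiv}%qT x.

Lemma tensor_seqK : cancel tensor_seq tensor_class.
Proof. by move=> x; exact: reprK. Qed.

Lemma tensor_classP s t : tensor_class s = tensor_class t <-> tensor_rel s t.
Proof.
split=> [|h]; first by move/eqmodP => /asboolP.
by apply/eqmodP/asboolP.
Qed.

Lemma tensor_seq_class s : tensor_rel (tensor_seq (tensor_class s)) s.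
Proof. by apply/tensor_classP; rewrite tensor_seqK. Qed.

Definition tensor_add (x y : tensor) : tensor :=
  tensor_class (tensor_seq x ++ tensor_seq y).

Lemma tensor_add_class s t :
  tensor_add (tensor_class s) (tensor_class t) = tensor_class (s ++ t).
Proof. by apply/tensor_classP/tensor_rel_cat; exact: tensor_seq_class. Qed.

Lemma tensor_addA : associative tensor_add.
Proof.
move=> x y z; rewrite -[x]tensor_seqK -[y]tensor_seqK -[z]tensor_seqK.
by rewrite !tensor_add_class catA.
Qed.

Lemma tensor_addC : commutative tensor_add.
Proof. by move=> x y; apply/tensor_classP/tensor_rel_comm. Qed.

Lemma tensor_add0 : left_id (tensor_class [::]) tensor_add.
Proof. by move=> x; rewrite -[x]tensor_seqK tensor_add_class. Qed.

HB.instance Definition _ :=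
  GRing.isNmodule.Build tensor tensor_addA tensor_addC tensor_add0.

Lemma tensor_class_cat s t :
  tensor_class (s ++ t) = tensor_class s + tensor_class t.
Proof. by rewrite -tensor_add_class. Qed.

Definition tens (a : A) (b : B) : tensor := tensor_class [:: (a, b)].

Definition balanced (M : nmodType) (f : A -> B -> M) : Prop :=
  [/\ forall a a' b, f (a + a') b = f a b + f a' b,
      forall a b b', f a (b + b') = f a b + f a b',
      forall r a b, f (r *: a) b = f a (r *: b)
    & forall b, f 0 b = 0].

(* The additive map sending a ⊗ b to f a b; it is meaningful only when f is
   balanced, which makes it independent of the representatives (tensor_lift_tens
   and tensor_liftD). *)
Definition tensor_lift (M : nmodType) (f : A -> B -> M) (x : tensor) : M :=
  \sum_(p <- tensor_seq x) f p.1 p.2.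

Lemma tensor_classE s : tensor_class s = \sum_(p <- s) tens p.1 p.2.
Proof.
elim: s => [|[a b] s IHs]; first by rewrite big_nil.
by rewrite big_cons -IHs -tensor_class_cat.
Qed.

Lemma tensorE x : x = \sum_(p <- tensor_seq x) tens p.1 p.2.
Proof. by rewrite -tensor_classE tensor_seqK. Qed.

Lemma tens_balanced : balanced tens.
Proof.
split=> [a a' b|a b b'|r a b|b].
- by rewrite -tensor_class_cat; apply/tensor_classP/tensor_rel_Dl.
- by rewrite -tensor_class_cat; apply/tensor_classP/tensor_rel_Dr.
- exact/tensor_classP/tensor_rel_Z.
exact/tensor_classP/tensor_rel_0l.
Qed.

Lemma tensor_ind (P : tensor -> Prop) :
  P 0 -> (forall a b, P (tens a b)) ->
  (forall x y, P x -> P y -> P (x + y)) -> forall x, P x.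
Proof.
move=> P0 Pt PD x; rewrite [x]tensorE.
by elim: (tensor_seq x) => [|p s IHs]; rewrite ?big_nil// big_cons; apply: PD.
Qed.

Section Lift.
Variables (M : nmodType) (f : A -> B -> M).
Hypothesis fb : balanced f.

Lemma balanced_sum s t : tensor_rel s t ->
  \sum_(p <- s) f p.1 p.2 = \sum_(p <- t) f p.1 p.2.
Proof.
case: fb => fDl fDr fZ f0.
elim=> {s t} [//|s t _ -> //|s t u _ -> _ -> //|s s' t t' _ IHs _ IHt
  |s t|a a' b|a b b'|r a b|b]; rewrite ?big_cat /= ?big_cons ?big_nil ?addr0 //=.
- by rewrite IHs IHt.
- by rewrite addrC.
Qed.

Lemma tensor_lift_class s :
  tensor_lift f (tensor_class s) = \sum_(p <- s) f p.1 p.2.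
Proof. exact/balanced_sum/tensor_seq_class. Qed.

Lemma tensor_lift_tens a b : tensor_lift f (tens a b) = f a b.
Proof. by rewrite tensor_lift_class big_cons big_nil addr0. Qed.

Lemma tensor_lift0 : tensor_lift f 0 = 0.
Proof. by rewrite tensor_lift_class big_nil. Qed.

Lemma tensor_liftD x y : tensor_lift f (x + y) = tensor_lift f x + tensor_lift f y.
Proof. by rewrite tensor_lift_class big_cat. Qed.

End Lift.

Lemma eq_tensor_lift (M : nmodType) (f g : A -> B -> M) :
  (forall a b, f a b = g a b) -> tensor_lift f =1 tensor_lift g.
Proof. by move=> fg x; apply: eq_bigr => p _; exact: fg. Qed.

Lemma tensor_oppb : balanced (fun a b => tens (- a) b).
Proof.
have [tDl tDr tZ t0] := tens_balanced.
by split=> *; rewrite ?opprD ?oppr0 -?scalerN ?tDl ?tDr ?tZ ?t0.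
Qed.

Definition tensor_opp : tensor -> tensor :=
  tensor_lift (fun a b => tens (- a) b).

Lemma tensor_addN : left_inverse 0 tensor_opp +%R.
Proof.
have [tDl _ _ t0] := tens_balanced.
apply: tensor_ind => [|a b|x y IHx IHy].
- by rewrite /tensor_opp (tensor_lift0 tensor_oppb) addr0.
- by rewrite /tensor_opp (tensor_lift_tens tensor_oppb) -tDl addNr t0.
by rewrite /tensor_opp (tensor_liftD tensor_oppb) addrACA IHx IHy addr0.
Qed.

HB.instance Definition _ := GRing.Nmodule_isZmodule.Build tensor tensor_addN.

Lemma tensor_scaleb r : balanced (fun a b => tens (r *: a) b).
Proof.
have [tDl tDr tZ t0] := tens_balanced.
split=> *; rewrite ?scalerDr ?scaler0 ?tDl ?tDr ?t0 //.
by rewrite scalerA mulrC -scalerA tZ.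
Qed.

Definition tensor_scale (r : R) : tensor -> tensor :=
  tensor_lift (fun a b => tens (r *: a) b).

Let scaleD r x y :
  tensor_scale r (x + y) = tensor_scale r x + tensor_scale r y.
Proof. exact: tensor_liftD (tensor_scaleb r) x y. Qed.
Let scale0 r : tensor_scale r 0 = 0.
Proof. exact: tensor_lift0 (tensor_scaleb r). Qed.
Let scale_tens r a b : tensor_scale r (tens a b) = tens (r *: a) b.
Proof. exact: tensor_lift_tens (tensor_scaleb r) a b. Qed.

Lemma tensor_scaleA r s x :
  tensor_scale r (tensor_scale s x) = tensor_scale (r * s) x.
Proof.
elim/tensor_ind: x => [|a b|x y IHx IHy]; first by rewrite !scale0.
  by rewrite !scale_tens scalerA.
by rewrite !scaleD IHx IHy.
Qed.

Lemma tensor_scale1 : left_id 1 tensor_scale.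
Proof.
elim/tensor_ind=> [|a b|x y IHx IHy]; first by rewrite !scale0.
  by rewrite !scale_tens scale1r.
by rewrite !scaleD IHx IHy.
Qed.

Lemma tensor_scaleDr : right_distributive tensor_scale +%R.
Proof. exact: scaleD. Qed.

Lemma tensor_scaleDl x : {morph tensor_scale^~ x : r s / r + s}.
Proof.
have [tDl _ _ _] := tens_balanced.
move=> r s; elim/tensor_ind: x => [|a b|x y IHx IHy].
- by rewrite !scale0 addr0.
- by rewrite !scale_tens scalerDl tDl.
by rewrite !scaleD IHx IHy addrACA.
Qed.

HB.instance Definition _ := GRing.Zmodule_isLmodule.Build R tensor
  tensor_scaleA tensor_scale1 tensor_scaleDr tensor_scaleDl.

End TensorProduct.

Arguments tens {R A B} a b.

Notation "A ⊗ B" := (tensor A%type B%type) : type_scope.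
Notation "a ⊗ b" := (tens a b) : ring_scope.

Section TensorTheory.
Variables (R : comPzRingType) (A B : lmodType R).

Lemma tensDl (a a' : A) (b : B) : (a + a') ⊗ b = a ⊗ b + a' ⊗ b.
Proof. by case: (tens_balanced A B). Qed.

Lemma tensDr (a : A) (b b' : B) : a ⊗ (b + b') = a ⊗ b + a ⊗ b'.
Proof. by case: (tens_balanced A B). Qed.

Lemma tensZl r (a : A) (b : B) : (r *: a) ⊗ b = r *: (a ⊗ b).
Proof. by rewrite -[RHS]/(tensor_scale r _) /tensor_scale
  (tensor_lift_tens (tensor_scaleb _ _ r)). Qed.

Lemma tensZr r (a : A) (b : B) : a ⊗ (r *: b) = r *: (a ⊗ b).
Proof. by rewrite -tensZl; case: (tens_balanced A B). Qed.

Lemma tens0l (b : B) : (0 : A) ⊗ b = 0.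
Proof. by case: (tens_balanced A B). Qed.

Lemma tens0r (a : A) : a ⊗ (0 : B) = 0.
Proof. by rewrite -[0 : B](scale0r 0) tensZr scale0r. Qed.

Definition bilin (M : lmodType R) (f : A -> B -> M) : Prop :=
  (forall b, linear (f^~ b)) /\ (forall a, linear (f a)).

Section Bilin.
Variables (M : lmodType R) (f : A -> B -> M).
Hypothesis fb : bilin f.

Lemma bilinDl a a' b : f (a + a') b = f a b + f a' b.
Proof. by have := fb.1 b 1 a a'; rewrite !scale1r. Qed.
Lemma bilinDr a b b' : f a (b + b') = f a b + f a b'.
Proof. by have := fb.2 a 1 b b'; rewrite !scale1r. Qed.
Lemma bilin0l b : f 0 b = 0.
Proof. by apply: (addIr (f 0 b)); rewrite -bilinDl !add0r. Qed.
Lemma bilin0r a : f a 0 = 0.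
Proof. by apply: (addIr (f a 0)); rewrite -bilinDr !add0r. Qed.
Lemma bilinZl r a b : f (r *: a) b = r *: f a b.
Proof. by have := fb.1 b r a 0; rewrite bilin0l !addr0. Qed.
Lemma bilinZr r a b : f a (r *: b) = r *: f a b.
Proof. by have := fb.2 a r b 0; rewrite bilin0r !addr0. Qed.

Lemma bilin_balanced : balanced f.
Proof.
split; [exact: bilinDl|exact: bilinDr|move=> *|exact: bilin0l].
by rewrite bilinZl bilinZr.
Qed.

Lemma lift_tens a b : tensor_lift f (a ⊗ b) = f a b.
Proof. exact: tensor_lift_tens bilin_balanced a b. Qed.

Lemma lift_linear : linear (tensor_lift f).
Proof.
move=> r x y; rewrite (tensor_liftD bilin_balanced); congr (_ + _).
elim/tensor_ind: x => [|a b|u v IHu IHv].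
- by rewrite scaler0 (tensor_lift0 bilin_balanced) scaler0.
- by rewrite -tensZl !lift_tens bilinZl.
by rewrite scalerDr !(tensor_liftD bilin_balanced) IHu IHv scalerDr.
Qed.

End Bilin.

Lemma eq_linear_tensor (M : lmodType R) (f g : A ⊗ B -> M) :
  linear f -> linear g -> (forall a b, f (a ⊗ b) = g (a ⊗ b)) -> f =1 g.
Proof.
move=> fl gl fg x.
have D h : linear h -> forall x y : A ⊗ B, h (x + y) = h x + h y :> M.
  by move=> hl u v; have := hl 1 u v; rewrite !scale1r.
have Z h : linear h -> h (0 : A ⊗ B) = 0 :> M.
  by move=> hl; apply: (addIr (h 0)); rewrite -D// !add0r.
elim/tensor_ind: x => [|a b|u v IHu IHv]; [by rewrite !Z|exact: fg|].
by rewrite !D// IHu IHv.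
Qed.

End TensorTheory.

Section TensorMaps.
Variable R : comPzRingType.

Definition tensor_map (A B C D : lmodType R) (f : A -> C) (g : B -> D) :
    A ⊗ B -> C ⊗ D :=
  tensor_lift (fun a b => f a ⊗ g b).

Definition tensor_assoc (A B C : lmodType R) :
    (A ⊗ B) ⊗ C -> A ⊗ (B ⊗ C) :=
  tensor_lift (fun x c => tensor_lift (fun a b => a ⊗ (b ⊗ c)) x).

End TensorMaps.

Section LiftFun.
Variables (R : comPzRingType) (A B : lmodType R) (M : lmodType R).

Lemma tensor_lift_linear_fun r (f g : A -> B -> M) x :
  tensor_lift (fun a b => r *: f a b + g a b) x =
  r *: tensor_lift f x + tensor_lift g x.
Proof. by rewrite /tensor_lift big_split scaler_sumr. Qed.

End LiftFun.

Section TensorAlgebra.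
Variables (R : comPzRingType) (A B : algType R).

Definition tensor_mul (x y : A ⊗ B) : A ⊗ B :=
  tensor_lift (fun a b => tensor_lift (fun c d => (a * c) ⊗ (b * d)) y) x.

Let innerb a b : bilin (fun (c : A) (d : B) => (a * c) ⊗ (b * d)).
Proof.
split=> [d|c] r u v; rewrite mulrDr -scalerAr ?tensDl ?tensDr.
  by rewrite tensZl.
by rewrite tensZr.
Qed.

Let outerb y : bilin (fun (a : A) (b : B) =>
  tensor_lift (fun c d => (a * c) ⊗ (b * d)) y).
Proof.
split=> [b|a] r u v; rewrite -tensor_lift_linear_fun;
  apply: eq_tensor_lift => c d; rewrite mulrDl -scalerAl ?tensDl ?tensDr.
  by rewrite tensZl.
by rewrite tensZr.
Qed.

Lemma tensor_mulDl : left_distributive tensor_mul +%R.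
Proof. by move=> x y z; apply: (tensor_liftD (bilin_balanced (outerb z))). Qed.

Lemma tensor_mulDr : right_distributive tensor_mul +%R.
Proof.
move=> x y z; rewrite /tensor_mul -[tensor_lift _ x as X in _ = X + _]scale1r.
rewrite -tensor_lift_linear_fun; apply: eq_tensor_lift => a b.
by rewrite scale1r (tensor_liftD (bilin_balanced (innerb a b))).
Qed.

Lemma tensor_mul_tens a b c d :
  tensor_mul (a ⊗ b) (c ⊗ d) = (a * c) ⊗ (b * d).
Proof. by rewrite /tensor_mul (lift_tens (outerb _)) (lift_tens (innerb _ _)). Qed.

Let mul0l y : tensor_mul 0 y = 0.
Proof. by apply: (addIr (tensor_mul 0 y)); rewrite -tensor_mulDl !add0r. Qed.
Let mul0r y : tensor_mul y 0 = 0.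
Proof. by apply: (addIr (tensor_mul y 0)); rewrite -tensor_mulDr !add0r. Qed.

Lemma tensor_mulA : associative tensor_mul.
Proof.
elim/tensor_ind=> [|a b|x x' IHx IHx'] y z; first by rewrite !mul0l.
  2: by rewrite !tensor_mulDl IHx IHx'.
elim/tensor_ind: y => [|c d|y y' IHy IHy']; first by rewrite !(mul0l, mul0r).
  2: by rewrite !(tensor_mulDl, tensor_mulDr) IHy IHy'.
elim/tensor_ind: z => [|e f|z z' IHz IHz']; first by rewrite !mul0r.
  by rewrite !tensor_mul_tens !mulrA.
by rewrite !tensor_mulDr IHz IHz'.
Qed.

Lemma tensor_mul1 : left_id (1 ⊗ 1) tensor_mul.
Proof.
elim/tensor_ind=> [|a b|x y IHx IHy]; first by rewrite mul0r.
  by rewrite tensor_mul_tens !mul1r.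
by rewrite tensor_mulDr IHx IHy.
Qed.

Lemma tensor_mulr1 : right_id (1 ⊗ 1) tensor_mul.
Proof.
elim/tensor_ind=> [|a b|x y IHx IHy]; first by rewrite mul0l.
  by rewrite tensor_mul_tens !mulr1.
by rewrite tensor_mulDl IHx IHy.
Qed.

HB.instance Definition _ := GRing.Zmodule_isPzRing.Build (A ⊗ B)%type
  tensor_mulA tensor_mul1 tensor_mulr1 tensor_mulDl tensor_mulDr.

Lemma tensM (a c : A) (b d : B) : (a ⊗ b) * (c ⊗ d) = (a * c) ⊗ (b * d).
Proof. exact: tensor_mul_tens. Qed.

Lemma tens1 : (1 : A) ⊗ (1 : B) = 1.
Proof. by []. Qed.

End TensorAlgebra.

HB.mixin Record isHopfAlgebra (R : comNzRingType) H of GRing.Algebra R H := {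
  comul : {lrmorphism H -> H ⊗ H};
  counit : {lrmorphism H -> R | *%R};
  antipode : {linear H -> H};
  comulA : forall h,
    tensor_assoc (tensor_map comul idfun (comul h)) =
    tensor_map idfun comul (comul h);
  comul_counitl : forall h, tensor_lift (fun a b => counit a *: b) (comul h) = h;
  comul_counitr : forall h, tensor_lift (fun a b => counit b *: a) (comul h) = h;
  comul_antipodel : forall h,
    tensor_lift (fun a b => antipode a * b) (comul h) = (counit h)%:A;
  comul_antipoder : forall h,
    tensor_lift (fun a b => a * antipode b) (comul h) = (counit h)%:A
}.

#[short(type="hopfAlgType")]
HB.structure Definition HopfAlgebra (R : comNzRingType) :=
  { H of isHopfAlgebra R H & GRing.Algebra R H }.

Section HopfTheory.
Variables (R : comNzRingType) (H : hopfAlgType R).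
Implicit Types h : H.

Lemma tensor_map_comull_bilin :
  bilin (fun a b : H => comul a ⊗ b : (H ⊗ H) ⊗ H).
Proof.
split=> [b|a] r u v.
  by rewrite linearD linearZ tensDl tensZl.
by rewrite tensDr tensZr.
Qed.

Lemma tensor_map_comulr_bilin :
  bilin (fun a b : H => a ⊗ comul b : H ⊗ (H ⊗ H)).
Proof.
split=> [b|a] r u v.
  by rewrite tensDl tensZl.
by rewrite linearD linearZ tensDr tensZr.
Qed.

Lemma tensor_assoc_inner_bilin (c : H) :
  bilin (fun a b : H => a ⊗ (b ⊗ c)).
Proof.
split=> [b|a] r u v; rewrite ?tensDl ?tensZl //.
by rewrite tensDr tensZr.
Qed.

Lemma tensor_assoc_bilin :
  bilin (fun (x : H ⊗ H) (c : H) => tensor_lift (fun a b : H => a ⊗ (b ⊗ c)) x).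
Proof.
split=> [c|x] r u v.
  exact: (lift_linear (tensor_assoc_inner_bilin c)).
rewrite -tensor_lift_linear_fun; apply: eq_tensor_lift => a b.
by rewrite !(tensDr, tensZr).
Qed.

Section Coassociativity.
Variables (M : lmodType R) (f : H -> H -> H -> M).
Hypothesis f1 : forall b c, linear (fun a => f a b c).
Hypothesis f2 : forall a c, linear (fun b => f a b c).
Hypothesis f3 : forall a b, linear (fun c => f a b c).

Let b12 c : bilin (fun a b => f a b c). Proof. by split=> ?. Qed.
Let b23 a : bilin (f a). Proof. by split=> ?; [exact: f2|exact: f3]. Qed.

Let F_bilin : bilin (fun (a : H) (z : H ⊗ H) => tensor_lift (f a) z).
Proof.
split=> [z|a] r u v; last exact: (lift_linear (b23 a)).
by rewrite -tensor_lift_linear_fun; apply: eq_tensor_lift => b c; exact: f1.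
Qed.

Let F := tensor_lift (fun (a : H) (z : H ⊗ H) => tensor_lift (f a) z).

Lemma comul_lift_assoc h :
  tensor_lift (fun x c => tensor_lift (fun a b => f a b c) (comul x)) (comul h)
  = tensor_lift (fun a y => tensor_lift (f a) (comul y)) (comul h).
Proof.
have Fl : linear F := lift_linear F_bilin.
have comp (U V W : lmodType R) (p : V -> W) (q : U -> V) :
    linear p -> linear q -> linear (p \o q).
  by move=> pl ql r u v /=; rewrite ql pl.
transitivity (F (tensor_assoc (tensor_map comul idfun (comul h)))).
  apply: (eq_linear_tensor (f := tensor_lift _)
    (g := F \o (@tensor_assoc _ H H H \o tensor_map comul idfun))).
  - apply: lift_linear; split=> [c|x] r u v /=.
      by rewrite linearD linearZ /= (lift_linear (b12 c)).
    by rewrite -tensor_lift_linear_fun; apply: eq_tensor_lift => a b; exact: f3.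
  - apply: (comp) => //; apply: (comp).
      exact: (lift_linear tensor_assoc_bilin).
    exact: (lift_linear tensor_map_comull_bilin).
  move=> x c; rewrite lift_tens; last first.
    split=> [d|y] r u v /=.
      by rewrite linearD linearZ /= (lift_linear (b12 d)).
    by rewrite -tensor_lift_linear_fun; apply: eq_tensor_lift => a b; exact: f3.
  rewrite /= /tensor_map (lift_tens tensor_map_comull_bilin).
  rewrite /tensor_assoc (lift_tens tensor_assoc_bilin).
  apply: (eq_linear_tensor (f := tensor_lift _) (g := F \o tensor_lift _)).
  - exact: lift_linear (b12 c).
  - by apply: (comp) => //; apply: (lift_linear (tensor_assoc_inner_bilin c)).
  move=> a b; rewrite (lift_tens (b12 c)) /=.
  rewrite (lift_tens (tensor_assoc_inner_bilin c)).
  by rewrite /F (lift_tens F_bilin) (lift_tens (b23 a)).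
rewrite comulA.
have Gb : bilin (fun a y => tensor_lift (f a) (comul y)).
  split=> [y|a] r u v /=.
    by rewrite -tensor_lift_linear_fun; apply: eq_tensor_lift => b c; exact: f1.
  by rewrite linearD linearZ /= (lift_linear (b23 a)).
apply: (eq_linear_tensor (f := F \o tensor_map idfun comul)
  (g := tensor_lift _)).
- by apply: (comp) => //; apply: (lift_linear tensor_map_comulr_bilin).
- exact: lift_linear Gb.
move=> a y; rewrite (lift_tens Gb) /= /tensor_map.
by rewrite (lift_tens tensor_map_comulr_bilin) /F (lift_tens F_bilin).
Qed.

End Coassociativity.

End HopfTheory.

Section Weights.
Variables (R : comNzRingType) (H : hopfAlgType R).
Implicit Types (lam nu mu : {lrmorphism H -> R | *%R}) (h : H).

Definition weight := {lrmorphism H -> R | *%R}.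

HB.instance Definition _ := gen_eqMixin weight.
HB.instance Definition _ := gen_choiceMixin weight.

Lemma weightP (lam nu : weight) : lam =1 nu -> lam = nu.
Proof.
case: lam nu => [f cf] [g cg] /= /funext fg; move: cf cg; rewrite {f}fg => cf cg.
congr GRing.LRMorphism.Pack.
case: cf cg => [[a1] [b1] [c1]] [[a2] [b2] [c2]].
by congr GRing.LRMorphism.Class; f_equal; exact: Prop_irrelevance.
Qed.

Lemma weightZ lam r h : lam (r *: h) = r * lam h.
Proof. exact: (linearZ_LR lam). Qed.

(* lam ⊗ nu, followed by the multiplication R ⊗ R -> R *)
Definition weight_tensor lam nu : H ⊗ H -> R :=
  tensor_lift (fun a b => lam a * nu b).

Definition conv lam nu : H -> R := weight_tensor lam nu \o comul.

Let wbilin lam nu : @bilin R H H R^o (fun a b => lam a * nu b).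
Proof.
split=> [b|a] r u v.
  rewrite -[RHS]/(r * (lam u * nu b) + lam v * nu b).
  by rewrite raddfD /= weightZ mulrDl mulrA.
rewrite -[RHS]/(r * (lam a * nu u) + lam a * nu v).
by rewrite raddfD /= weightZ mulrDr mulrCA.
Qed.

Lemma weight_tensor_tens lam nu a b :
  weight_tensor lam nu (a ⊗ b) = lam a * nu b.
Proof. exact: (lift_tens (wbilin lam nu)). Qed.

Lemma weight_tensor_linear lam nu :
  @GRing.linear_for R (H ⊗ H)%type R *%R (weight_tensor lam nu).
Proof. exact: (lift_linear (wbilin lam nu)). Qed.

HB.instance Definition _ lam nu :=
  GRing.isLinear.Build R (H ⊗ H)%type R *%R (weight_tensor lam nu)
    (weight_tensor_linear lam nu).

Lemma weight_tensor_monoid lam nu : monoid_morphism (weight_tensor lam nu).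
Proof.
split; first by rewrite -tens1 weight_tensor_tens !rmorph1 mulr1.
move=> x y; elim/tensor_ind: x => [|a b|x x' IHx IHx'].
- by rewrite mul0r raddf0 mul0r.
- elim/tensor_ind: y => [|c d|y y' IHy IHy'].
  + by rewrite mulr0 raddf0 mulr0.
  + by rewrite tensM !weight_tensor_tens !rmorphM mulrACA.
  by rewrite mulrDr !raddfD mulrDr /= IHy IHy'.
by rewrite mulrDl !raddfD mulrDl /= IHx IHx'.
Qed.

HB.instance Definition _ lam nu :=
  GRing.isMonoidMorphism.Build (H ⊗ H)%type R (weight_tensor lam nu)
    (weight_tensor_monoid lam nu).

HB.instance Definition _ lam nu := GRing.RMorphism.on (conv lam nu).
HB.instance Definition _ lam nu := GRing.Linear.on (conv lam nu).

Definition weight_mul (lam nu : weight) : weight := conv lam nu.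

Definition weight_one : weight := counit.

Lemma convE lam nu h :
  conv lam nu h = tensor_lift (fun a b => lam a * nu b) (comul h).
Proof. by []. Qed.

Lemma weight_mulA : associative weight_mul.
Proof.
move=> lam nu mu; apply: weightP => h; apply/esym.
transitivity (tensor_lift (fun x c =>
    tensor_lift (fun a b => lam a * nu b * mu c : R^o) (comul x)) (comul h)).
  by apply: eq_tensor_lift => x c; rewrite /= convE /tensor_lift mulr_suml.
rewrite comul_lift_assoc; first last.
- move=> a b r u v; rewrite -[RHS]/(r * (lam a * nu b * mu u) + lam a * nu b * mu v).
  by rewrite raddfD /= weightZ mulrDr mulrCA.
- move=> a c r u v; rewrite -[RHS]/(r * (lam a * nu u * mu c) + lam a * nu v * mu c).
  by rewrite raddfD /= weightZ mulrDr mulrDl !mulrA [lam a * r]mulrC.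
- move=> b c r u v; rewrite -[RHS]/(r * (lam u * nu b * mu c) + lam v * nu b * mu c).
  by rewrite raddfD /= weightZ !mulrDl !mulrA.
apply: eq_tensor_lift => a y; rewrite /= convE /tensor_lift mulr_sumr.
by apply: eq_bigr => p _; rewrite mulrA.
Qed.

Lemma weight_mul1 : left_id weight_one weight_mul.
Proof.
move=> lam; apply: weightP => h; rewrite /= convE.
rewrite -[in RHS](comul_counitl h) /tensor_lift raddf_sum.
by apply: eq_bigr => p _; rewrite /= weightZ.
Qed.

Lemma weight_mulr1 : right_id weight_one weight_mul.
Proof.
move=> lam; apply: weightP => h; rewrite /= convE.
rewrite -[in RHS](comul_counitr h) /tensor_lift raddf_sum.
by apply: eq_bigr => p _; rewrite /= weightZ mulrC.
Qed.

Section Inverse.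
Variable lam : weight.

Let m h : R := lam (antipode h).

Let mlin : linear (m : H -> R^o).
Proof. by move=> r u v; rewrite /m [antipode _]linearP raddfD /= weightZ. Qed.

Let mD u v : m (u + v) = m u + m v.
Proof. by have := mlin 1 u v; rewrite !scale1r. Qed.
Let m0 : m 0 = 0.
Proof. by rewrite /m !raddf0. Qed.
Let mZ r u : m (r *: u) = r * m u.
Proof. by have := mlin r u 0; rewrite m0 !addr0. Qed.

Let m_sum I (s : seq I) (F : I -> H) :
  m (\sum_(i <- s) F i) = \sum_(i <- s) m (F i).
Proof. exact: (big_morph m mD m0). Qed.

Let m1 : m 1 = 1.
Proof.
have := comul_antipodel (1 : H); rewrite !rmorph1 scale1r -tens1 lift_tens.
  by rewrite mulr1 /m => ->; rewrite rmorph1.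
split=> [b|a] r u v.
  by rewrite linearD linearZ mulrDl scalerAl.
by rewrite mulrDr scalerAr.
Qed.

Let conv_ml h : tensor_lift (fun a b => m a * lam b) (comul h) = counit h.
Proof.
transitivity (lam (counit h)%:A); last by rewrite weightZ rmorph1 mulr1.
rewrite -comul_antipodel /tensor_lift raddf_sum.
by apply: eq_bigr => p _; rewrite /= rmorphM.
Qed.

Let conv_mr h : tensor_lift (fun a b => lam a * m b) (comul h) = counit h.
Proof.
transitivity (lam (counit h)%:A); last by rewrite weightZ rmorph1 mulr1.
rewrite -comul_antipoder /tensor_lift raddf_sum.
by apply: eq_bigr => p _; rewrite /= rmorphM.
Qed.

Let m_counitl h : tensor_lift (fun a b => counit a * m b) (comul h) = m h.
Proof.
rewrite -[in RHS](comul_counitl h) /tensor_lift m_sum.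
by apply: eq_bigr => p _; rewrite mZ.
Qed.

(* Both m (a b) and m a * m b are convolution inverses, on H ⊗ H, of
   lam (a b) = lam a * lam b. *)
Let T (a1 a2 a3 b1 b2 b3 : H) : R^o :=
  m (a1 * b1) * (lam a2 * lam b2) * (m a3 * m b3).

Let mbilin : @bilin R H H R^o (fun a b => m a * lam b).
Proof.
split=> [b|a] r u v.
  rewrite -[RHS]/(r * (m u * lam b) + m v * lam b).
  by rewrite mD mZ mulrDl mulrA.
rewrite -[RHS]/(r * (m a * lam u) + m a * lam v).
by rewrite raddfD /= weightZ mulrDr mulrCA.
Qed.

Let conv_m_mul (x y : H ⊗ H) :
  tensor_lift (fun a1 a2 => tensor_lift (fun b1 b2 =>
    m (a1 * b1) * (lam a2 * lam b2)) y) x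
  = tensor_lift (fun a b => m a * lam b) (x * y).
Proof.
rewrite [x in RHS]tensorE [y in RHS]tensorE mulr_suml.
pose W := tensor_lift (fun a b => m a * lam b) : H ⊗ H -> R^o.
have Wl : linear W := lift_linear mbilin.
have WD u v : W (u + v) = W u + W v by have := Wl 1 u v; rewrite !scale1r.
have W0 : W 0 = 0 by apply: (addIr (W 0)); rewrite -WD !add0r.
rewrite -/(W _) (big_morph W WD W0) /tensor_lift; apply: eq_bigr => p _.
rewrite mulr_sumr (big_morph W WD W0); apply: eq_bigr => q _.
by rewrite tensM /W (lift_tens mbilin) rmorphM.
Qed.

Let lift_mul (M1 M2 : H -> H -> R) (x y : H ⊗ H) :
  tensor_lift M1 x * tensor_lift M2 y =
  tensor_lift (fun a b => tensor_lift (fun c d => M1 a b * M2 c d) y) x.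
Proof.
by rewrite /tensor_lift mulr_suml; apply: eq_bigr => p _; rewrite mulr_sumr.
Qed.

Let exchange (M1 : H -> H -> H -> H -> R^o) (x y : H ⊗ H) :
  tensor_lift (fun a b => tensor_lift (fun c d => M1 a b c d) y) x =
  tensor_lift (fun c d => tensor_lift (fun a b => M1 a b c d) x) y.
Proof. by rewrite /tensor_lift exchange_big. Qed.

Let mM a b : m (a * b) = m a * m b.
Proof.
transitivity (tensor_lift (fun a1 x => tensor_lift (fun b1 y =>
    tensor_lift (fun a2 a3 => tensor_lift (fun b2 b3 =>
      T a1 a2 a3 b1 b2 b3) (comul y)) (comul x)) (comul b)) (comul a)).
  rewrite -[in LHS](comul_counitr a) -[in LHS](comul_counitr b).
  rewrite /tensor_lift mulr_suml m_sum; apply: eq_bigr => p _.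
  rewrite mulr_sumr m_sum; apply: eq_bigr => q _.
  rewrite -scalerAl -scalerAr !mZ -(conv_mr p.2) -(conv_mr q.2) mulrA lift_mul.
  rewrite mulrC /tensor_lift mulr_sumr; apply: eq_bigr => u _.
  rewrite mulr_sumr; apply: eq_bigr => v _.
  by rewrite /T -[RHS]mulrA [in RHS]mulrACA.
transitivity (tensor_lift (fun a1 x => tensor_lift (fun a2 a3 =>
    tensor_lift (fun y b3 => tensor_lift (fun b1 b2 =>
      T a1 a2 a3 b1 b2 b3) (comul y)) (comul b)) (comul x)) (comul a)).
  apply: eq_tensor_lift => a1 x; rewrite exchange.
  apply: eq_tensor_lift => a2 a3; rewrite comul_lift_assoc //.
  - move=> b2 b3 r u v; rewrite -[RHS]/(r * T a1 a2 a3 u b2 b3 + T a1 a2 a3 v b2 b3).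
    by rewrite /T mulrDr -scalerAr mD mZ !mulrDl !mulrA.
  - move=> b1 b3 r u v; rewrite -[RHS]/(r * T a1 a2 a3 b1 u b3 + T a1 a2 a3 b1 v b3).
    by rewrite /T raddfD /= weightZ; ring.
  move=> b1 b2 r u v; rewrite -[RHS]/(r * T a1 a2 a3 b1 b2 u + T a1 a2 a3 b1 b2 v).
  by rewrite /T mD mZ; ring.
rewrite -comul_lift_assoc; first last.
- move=> a1 a2 r u v; rewrite -tensor_lift_linear_fun.
  apply: eq_tensor_lift => y b3; rewrite -tensor_lift_linear_fun.
  apply: eq_tensor_lift => b1 b2.
  rewrite -[RHS]/(r * T a1 a2 u b1 b2 b3 + T a1 a2 v b1 b2 b3).
  by rewrite /T mD mZ; ring.
- move=> a1 a3 r u v; rewrite -tensor_lift_linear_fun.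
  apply: eq_tensor_lift => y b3; rewrite -tensor_lift_linear_fun.
  apply: eq_tensor_lift => b1 b2.
  rewrite -[RHS]/(r * T a1 u a3 b1 b2 b3 + T a1 v a3 b1 b2 b3).
  by rewrite /T raddfD /= weightZ; ring.
- move=> a2 a3 r u v; rewrite -tensor_lift_linear_fun.
  apply: eq_tensor_lift => y b3; rewrite -tensor_lift_linear_fun.
  apply: eq_tensor_lift => b1 b2.
  rewrite -[RHS]/(r * T u a2 a3 b1 b2 b3 + T v a2 a3 b1 b2 b3).
  by rewrite /T mulrDl -scalerAl mD mZ !mulrDl !mulrA.
rewrite -[in RHS](m_counitl a) -[in RHS](m_counitl b) lift_mul.
apply: eq_tensor_lift => x a3; rewrite exchange.
apply: eq_tensor_lift => y b3.
transitivity (counit (x * y) * (m a3 * m b3)); last first.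
  by rewrite rmorphM mulrACA.
rewrite -conv_ml rmorphM /= -conv_m_mul /tensor_lift mulr_suml.
by apply: eq_bigr => p _; rewrite mulr_suml.
Qed.

Definition weight_inv_fun h : R := lam (antipode h).

Lemma weight_inv_linear : @GRing.linear_for R H R *%R weight_inv_fun.
Proof. exact: mlin. Qed.

Lemma weight_inv_monoid : monoid_morphism weight_inv_fun.
Proof. by split; [exact: m1|exact: mM]. Qed.

HB.instance Definition _ :=
  GRing.isLinear.Build R H R *%R weight_inv_fun weight_inv_linear.
HB.instance Definition _ :=
  GRing.isMonoidMorphism.Build H R weight_inv_fun weight_inv_monoid.

Definition weight_inv : weight := weight_inv_fun.

Lemma weight_mulV : weight_mul weight_inv lam = weight_one.
Proof. by apply: weightP => h; exact: conv_ml. Qed.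

Lemma weight_mulrV : weight_mul lam weight_inv = weight_one.
Proof. by apply: weightP => h; exact: conv_mr. Qed.

End Inverse.

HB.instance Definition _ := isGroup.Build weight
  weight_mulA weight_mul1 weight_mulr1 weight_mulV weight_mulrV.

End Weights.

Section WeightSums.
Variables (R : comNzRingType) (H : hopfAlgType R).
Implicit Types (Pi : {fset weight H}) (g h : H).

Definition grouplike g : Prop := comul g = g ⊗ g /\ counit g = 1.

Definition grouplike_fixed Pi g : Prop :=
  grouplike g /\ forall gam : weight H, gam \in Pi -> gam g = 1.

Definition skew_primitive (g g' h : H) : Prop :=
  [/\ grouplike g, grouplike g' & comul h = g ⊗ h + h ⊗ g'].

Definition weight_sum Pi h : R := \sum_(gam <- Pi) gam h.

End WeightSums.

(* Main.v *)
Require Import Defs.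
From mathcomp Require Import all_boot all_order all_algebra.
From mathcomp Require Import finmap boolp.

Set Implicit Arguments.
Unset Strict Implicit.
Unset Printing Implicit Defensive.

Import GRing.Theory.
Local Open Scope ring_scope.

(* Evaluating lam * gam and gam * lam at h and summing over gam in Pi gives
     (1 - lam g) S(h) = lam h S(g')   and   (1 - lam g') S(h) = lam h S(g),
   where S(x) is the sum over Pi at x.  For a grouplike x, S(x) is |Pi| when
   x is fixed by Pi, and 0 otherwise.  This gives the first two cases, since a
   group is not the union of two proper subgroups.  In the last case
   gam^-1 h = - gam h, so the terms with gam <> gam^-1 cancel in pairs. *)

(** * Cancellation of sums under an involution *)

Section InvolutionSums.

Lemma perm_map_involutive (T : eqType) (s : seq T) (f : T -> T) :
  uniq s -> involutive f -> {in s, forall x, f x \in s} ->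
  perm_eq (map f s) s.
Proof.
move=> us fK fs; apply: uniq_perm => //.
  by rewrite (map_inj_uniq (inv_inj fK)).
move=> x; apply/mapP/idP => [[y ys ->]|xs]; first exact: fs.
by exists (f x); [exact: fs|rewrite fK].
Qed.

(* Substituting f only gives that twice the sum is 0; fixed-point freeness is
   what makes this hold even when V has 2-torsion. *)
Lemma sum_involutive_opp (T : eqType) (V : zmodType) (s : seq T)
    (f : T -> T) (F : T -> V) (P : pred T) :
  uniq s -> involutive f -> {in s, forall x, f x \in s} ->
  {in s, forall x, P x -> f x != x} -> (forall x, P (f x) = P x) ->
  {in s, forall x, F (f x) = - F x} ->
  \sum_(x <- s | P x) F x = 0.
Proof.
(* From each pair [x], [f x] the predicate [lt] selects the member listed first in [s]; applying [f]
   exchanges the two halves of the sum. *)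
move=> us fK fs Pf fP Ff; pose lt x := (index x s < index (f x) s)%N.
rewrite (bigID lt) /=.
suff -> : \sum_(x <- s | P x && ~~ lt x) F x =
    - \sum_(x <- s | P x && lt x) F x by rewrite subrr.
rewrite -(perm_big _ (perm_map_involutive us fK fs)) big_map -sumrN.
rewrite big_seq_cond [RHS]big_seq_cond; apply: eq_big => [x|x /andP[xs _]].
  case: (boolP (x \in s)) => //= xs; rewrite fP /lt fK -leqNgt.
  (* Equal indices would make [x] a fixed point of [f], so the weak inequality is strict. *)
  case Px: (P x) => //=; rewrite leq_eqVlt.
  case: eqP => // ixx; have := Pf x xs Px.
  by rewrite -(nth_index x (fs x xs)) -ixx nth_index// eqxx.
exact: Ff.
Qed.

End InvolutionSums.

(** * Values of weights at grouplike and skew-primitive elements *)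

Section SkewPrimitive.
Variables (R : idomainType) (H : hopfAlgType R).
Implicit Types (Pi : {fset weight H}) (lam nu gam : weight H) (x g h : H).

Lemma weight_mulE lam nu x :
  (lam * nu)%g x = weight_tensor lam nu (comul x).
Proof. by []. Qed.

Lemma weight1E x : (1%g : weight H) x = counit x.
Proof. by []. Qed.

Lemma weight_mul_grouplike lam nu x :
  grouplike x -> (lam * nu)%g x = lam x * nu x.
Proof. by case=> xx _; rewrite weight_mulE xx weight_tensor_tens. Qed.

Lemma weight_mul_skew lam nu g g' h : skew_primitive g g' h ->
  (lam * nu)%g h = lam g * nu h + lam h * nu g'.
Proof.
by case=> _ _ hh; rewrite weight_mulE hh raddfD /= !weight_tensor_tens.
Qed.

Lemma weightV_grouplike lam x : grouplike x -> lam x * (lam^-1)%g x = 1.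
Proof.
by move=> xg; rewrite -weight_mul_grouplike// mulgV weight1E; case: xg.
Qed.

(** The counit is idempotent under convolution, so its value at [h] equals twice itself. *)
Lemma counit_skew g g' h : skew_primitive g g' h -> counit h = 0.
Proof.
move=> hh; have := weight_mul_skew 1%g 1%g hh.
rewrite mulg1 !weight1E; case: hh => -[_ ->] [_ ->] _.
by rewrite mul1r mulr1 => /eqP; rewrite -subr_eq subrr => /eqP.
Qed.

(** Evaluating [lam * lam^-1] at [h] gives [0 = lam g * lam^-1 h + lam h * lam^-1 g']. Here
    [lam^-1 g' = lam g], and this factor cancels because it is a unit. *)
Lemma weightV_skew lam g g' h : skew_primitive g g' h ->
  lam (g * g') = 1 -> (lam^-1)%g h = - lam h.
Proof.
move=> hh lgg'; have [gg gg' _] := hh.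
have lg' : (lam^-1)%g g' = lam g.
  rewrite -[LHS]mul1r -lgg' rmorphM -mulrA /=.
  by rewrite (weightV_grouplike _ gg') mulr1.
have lg0 : lam g != 0.
  apply: contraTneq (oner_neq0 R) => lg0.
  by rewrite -(weightV_grouplike lam gg) lg0 mul0r eqxx.
have := weight_mul_skew lam lam^-1%g hh.
rewrite mulgV weight1E (counit_skew hh) lg' [lam h * _]mulrC -mulrDr.
move=> /esym/eqP; rewrite mulf_eq0 (negPf lg0) /= addr_eq0.
by move/eqP.
Qed.

(** * Sums over a finite group of weights *)

Section Sums.
Variable Pi : {fset weight H}.
Hypothesis Pi_group : group_closed [in Pi].

Lemma perm_mulg_left lam : lam \in Pi -> perm_eq (map ( *%g lam) Pi) Pi.
Proof.
have PM := group_closedM Pi_group; have PV := group_closedV Pi_group.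
move=> lP; apply: uniq_perm; rewrite ?fset_uniq //.
  by rewrite map_inj_uniq ?fset_uniq //; exact: mulgI.
move=> x; apply/mapP/idP => [[y ys ->]|xs]; first exact: PM.
by exists (lam^-1 * x)%g; [exact: PM (PV _ lP) xs|rewrite mulVKg].
Qed.

Lemma perm_mulg_right lam : lam \in Pi -> perm_eq (map ( *%g^~ lam) Pi) Pi.
Proof.
have PM := group_closedM Pi_group; have PV := group_closedV Pi_group.
move=> lP; apply: uniq_perm; rewrite ?fset_uniq //.
  by rewrite map_inj_uniq ?fset_uniq //; exact: mulIg.
move=> x; apply/mapP/idP => [[y ys ->]|xs]; first exact: PM.
by exists (x * lam^-1)%g; [exact: PM xs (PV _ lP)|rewrite mulgVK].
Qed.

Lemma weight_sum_skew_left lam g g' h : lam \in Pi -> skew_primitive g g' h ->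
  (1 - lam g) * weight_sum Pi h = lam h * weight_sum Pi g'.
Proof.
move=> lP hh; rewrite mulrBl mul1r; apply/eqP; rewrite subr_eq addrC.
rewrite /weight_sum -[in X in X == _](perm_big _ (perm_mulg_left lP)) big_map.
rewrite !mulr_sumr -big_split; apply/eqP; apply: eq_bigr => gam _.
exact: weight_mul_skew.
Qed.

Lemma weight_sum_skew_right lam g g' h : lam \in Pi -> skew_primitive g g' h ->
  (1 - lam g') * weight_sum Pi h = lam h * weight_sum Pi g.
Proof.
move=> lP hh; rewrite mulrBl mul1r; apply/eqP; rewrite subr_eq.
rewrite /weight_sum -[in X in X == _](perm_big _ (perm_mulg_right lP)) big_map.
rewrite !mulr_sumr -big_split; apply/eqP; apply: eq_bigr => gam _.
by rewrite /= (weight_mul_skew _ _ hh) mulrC [lam g' * _]mulrC [lam h * _]mulrC.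
Qed.

(** This is the orthogonality argument for characters: evaluation at [x] is multiplicative in the
    weight, so translating [Pi] by [lam] multiplies the sum by [lam x]. *)
Lemma weight_sum_grouplike lam x : lam \in Pi -> grouplike x ->
  lam x != 1 -> weight_sum Pi x = 0.
Proof.
move=> lP xg lx1.
have : (1 - lam x) * weight_sum Pi x = 0.
  rewrite mulrBl mul1r; apply/eqP; rewrite subr_eq add0r.
  rewrite /weight_sum -[in X in X == _](perm_big _ (perm_mulg_left lP)) big_map.
  rewrite mulr_sumr; apply/eqP; apply: eq_bigr => gam _.
  exact: weight_mul_grouplike.
by move/eqP; rewrite mulf_eq0 subr_eq0 eq_sym (negPf lx1) => /eqP.
Qed.

Lemma weight_sum_fixed x : grouplike_fixed Pi x -> weight_sum Pi x = #|` Pi|%:R.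
Proof.
case=> _ x1; rewrite /weight_sum big_seq (eq_bigr (fun=> 1)) //.
by rewrite -big_seq big_const_seq count_predT iter_addr_0.
Qed.

Lemma not_grouplike_fixed x : grouplike x -> ~ grouplike_fixed Pi x ->
  exists2 lam, lam \in Pi & lam x != 1.
Proof.
move=> xg nx; apply: contrapT => nex; apply: nx; split=> // lam lP.
by apply/eqP/negPn/negP => lx; apply: nex; exists lam.
Qed.

Lemma fixed_or_fixed g g' : grouplike g -> grouplike g' ->
  ~ (exists2 lam, lam \in Pi & lam g <> 1 /\ lam g' <> 1) ->
  grouplike_fixed Pi g \/ grouplike_fixed Pi g'.
Proof.
move=> gg gg' nex.
have [?|/not_grouplike_fixed -/(_ gg) [a aP ag]] :=
  pselect (grouplike_fixed Pi g); first by left.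
have [?|/not_grouplike_fixed -/(_ gg') [b bP bg']] :=
  pselect (grouplike_fixed Pi g'); first by right.
have ag' : a g' = 1.
  by apply: contrapT => ag'; apply: nex; exists a => //; split=> //; exact/eqP.
have bg : b g = 1.
  by apply: contrapT => bg; apply: nex; exists b => //; split=> //; exact/eqP.
(* Since [a] moves only [g] and [b] moves only [g'], their product moves both. *)
case: nex; exists (a * b)%g; first exact: (group_closedM Pi_group).
rewrite !weight_mul_grouplike// ag' bg mulr1 mul1r.
by split; exact/eqP.
Qed.

(** The fixed grouplike contributes a factor 1 to [lam (g * g')], and its sum over [Pi] is the order
    of [Pi]. The translation relation with that sum on its right side is therefore the claim, with
    denominators cleared so as to stay in [R]. *)
Lemma weight_sum_one_fixed lam g g' h : lam \in Pi -> skew_primitive g g' h ->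
  grouplike_fixed Pi g \/ grouplike_fixed Pi g' ->
  (lam g == 1) != (lam g' == 1) ->
  1 - lam (g * g') != 0 /\
  (1 - lam (g * g')) * weight_sum Pi h = #|` Pi|%:R * lam h.
Proof.
move=> lP hh gf; rewrite rmorphM mulrC [_ * lam h]mulrC /=.
case: gf => fx; have lx := fx.2 _ lP; rewrite lx eqxx.
  rewrite mulr1 eq_sym eqb_id => l1; rewrite subr_eq0 eq_sym; split=> //.
  by rewrite (weight_sum_skew_right lP hh) weight_sum_fixed.
rewrite mul1r eqb_id => l1; rewrite subr_eq0 eq_sym; split=> //.
by rewrite (weight_sum_skew_left lP hh) weight_sum_fixed.
Qed.

Lemma weight_sum_inverse g g' h : skew_primitive g g' h ->
  (forall lam, lam \in Pi -> lam (g * g') = 1) ->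
  weight_sum Pi h =
    \sum_(gam <- Pi | (gam != 1%g) && ((gam ^+ 2)%g == 1%g)) gam h /\
  2 * weight_sum Pi h = 0.
Proof.
move=> hh gg'1; have PV := group_closedV Pi_group.
have hV : {in (Pi : seq _), forall gam, gam^-1%g h = - gam h}.
  by move=> gam /gg'1; exact: weightV_skew.
have sq gam : ((gam ^+ 2)%g == 1%g) = (gam^-1%g == gam).
  by rewrite expgS expg1 mulg_eq1 eq_sym.
split; last first.
  rewrite -[2]/(1 + 1) mulrDl mul1r; apply/eqP; rewrite addr_eq0; apply/eqP.
  (* Reindexing by inversion turns the sum into its own opposite. *)
  have PVp := perm_map_involutive (fset_uniq Pi) invgK PV.
  rewrite /weight_sum -[in LHS](perm_big _ PVp).
  rewrite big_map -sumrN big_seq [RHS]big_seq.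
  by apply: eq_bigr => gam; exact: hV.
rewrite /weight_sum (bigID (fun gam => (gam ^+ 2)%g == 1%g)) /=.
(* Inversion has no fixed point among the weights whose square is not 1, so their terms cancel. *)
rewrite [X in _ + X](@sum_involutive_opp _ _ _ (fun gam => gam^-1)%g) //;
  first last.
- by move=> gam; rewrite !sq invgK eq_sym.
- by move=> gam _; rewrite sq.
- exact: invgK.
- exact: fset_uniq.
(* The identity weight may be left out because the counit vanishes at [h]. *)
rewrite addr0 (bigID (fun gam => gam == 1%g)) /= [X in X + _]big1.
  by rewrite add0r; apply: eq_bigl => gam; rewrite andbC.
by move=> gam /andP[_ /eqP ->]; rewrite weight1E (counit_skew hh).
Qed.

End Sums.

End SkewPrimitive.

Theorem theorem3p6 (R : idomainType) (H : hopfAlgType R)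
  (Pi : {fset weight H}) (g g' h : H)
  (hPi : group_closed [in Pi])
  (hh : skew_primitive g g' h) :
  [/\ (* the three statements *)
      [/\ (exists2 lam : weight H, lam \in Pi & lam g <> 1 /\ lam g' <> 1) ->
          weight_sum Pi h = 0
        & ~ (exists2 lam : weight H, lam \in Pi & lam g <> 1 /\ lam g' <> 1) ->
          grouplike_fixed Pi g \/ grouplike_fixed Pi g'],
      (grouplike_fixed Pi g /\ ~ grouplike_fixed Pi g' \/
       ~ grouplike_fixed Pi g /\ grouplike_fixed Pi g') ->
      (exists2 lam : weight H, lam \in Pi & (lam g == 1) != (lam g' == 1)) /\
      (forall lam : weight H, lam \in Pi -> (lam g == 1) != (lam g' == 1) ->
        1 - lam (g * g') != 0 /\
        (weight_sum Pi h)%:F =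
          (#|` Pi|%:R * lam h)%:F / (1 - lam (g * g'))%:F :> {fraction R}),
      (forall lam : weight H, lam \in Pi -> lam (g * g') = 1) ->
      weight_sum Pi h =
        \sum_(gam <- Pi | (gam != 1%g) && ((gam ^+ 2)%g == 1%g)) gam h /\
      2 * weight_sum Pi h = 0
    & (* at least one of the three evaluations applies *)
      [\/ exists2 lam : weight H, lam \in Pi & lam g <> 1 /\ lam g' <> 1,
          grouplike_fixed Pi g /\ ~ grouplike_fixed Pi g' \/
          ~ grouplike_fixed Pi g /\ grouplike_fixed Pi g'
        | forall lam : weight H, lam \in Pi -> lam (g * g') = 1]].
Proof.
have [gg gg' _] := hh; split.
- split; last exact: fixed_or_fixed.
  move=> [lam lP [/eqP lg /eqP lg']].
  have := weight_sum_skew_left hPi lP hh.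
  rewrite (weight_sum_grouplike hPi lP gg' lg') mulr0 => /eqP.
  by rewrite mulf_eq0 subr_eq0 eq_sym (negPf lg) => /eqP.
- move=> one_fixed.
  have gf : grouplike_fixed Pi g \/ grouplike_fixed Pi g' by tauto.
  split; last first.
    move=> lam lP /(weight_sum_one_fixed hPi lP hh gf) [l1 lS]; split=> //.
    by rewrite -lS [_ * weight_sum _ _]mulrC rmorphM /= mulfK // tofrac_eq0.
  case: one_fixed => -[].
    move=> [_ g1] /(not_grouplike_fixed gg') [lam lP lg'].
    by exists lam => //; rewrite (g1 _ lP) eqxx eq_sym eqb_id.
  move=> /(not_grouplike_fixed gg) [lam lP lg] [_ g'1].
  by exists lam => //; rewrite (g'1 _ lP) eqxx eqb_id.
- exact: weight_sum_inverse.
have [|nex] := pselect (exists2 lam : weight H, lam \in Pi &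
  lam g <> 1 /\ lam g' <> 1).
  by constructor 1.
have := fixed_or_fixed hPi gg gg' nex.
(* At least one of [g], [g'] is now fixed: exactly one gives the second case, both give the
   third. *)
have [gf|] := pselect (grouplike_fixed Pi g); last by constructor 2; tauto.
have [g'f|] := pselect (grouplike_fixed Pi g'); last by constructor 2; tauto.
move=> _; constructor 3 => lam lP.
by rewrite rmorphM /= gf.2 ?g'f.2 ?mulr1.
Qed.
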